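(* There are $(G,N)$-implications that are not $(\mathcal{GO},N)$-implications; that is, there exist a grouping function $G$ and a fuzzy negation $N$ such that the function $(x,y)\mapsto G(N(x),y)$ on $[0,1]^2$ is not of the form $(x,y)\mapsto M(\mathcal{GO}(x,M(y)))$ for any bivariate general overlap function $\mathcal{GO}$ and any fuzzy negation $M$.
   Context: A fuzzy negation is a map $N:[0,1]\to[0,1]$ with $N(0)=1$, $N(1)=0$ and $N(x)\le N(y)$ whenever $y\le x$. A bivariate general overlap function is a function $\mathcal{GO}:[0,1]^2\to[0,1]$ such that for all $x,y\in[0,1]$: (1) $\mathcal{GO}(x,y)=\mathcal{GO}(y,x)$; (2) if $xy=0$ then $\mathcal{GO}(x,y)=0$; (3) if $xy=1$ then $\mathcal{GO}(x,y)=1$; (4) $\mathcal{GO}$ is increasing (in the non-strict sense) in each variable; (5) $\mathcal{GO}$ is continuous. A grouping function is a function $G:[0,1]^2\to[0,1]$ that is commutative, continuous, increasing (in the non-strict sense) in each variable, and satisfies $G(x,y)=0$ if and only if $x=y=0$, and $G(x,y)=1$ if and only if $x=1$ or $y=1$. A $(G,N)$-implication is a function of the form $(x,y)\mapsto G(N(x),y)$ with $G$ a grouping function and $N$ a fuzzy negation. A $(\mathcal{GO},N)$-implication is a function of the form $(x,y)\mapsto N(\mathcal{GO}(x,N(y)))$ with $\mathcal{GO}$ a bivariate general overlap function and $N$ a fuzzy negation. *)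

(* Defs.v *)
From HB Require Import structures.
From mathcomp Require Import all_boot all_order all_algebra.
From mathcomp Require Import all_classical all_reals all_analysis.
Import Order.TTheory GRing.Theory Num.Theory.
Import numFieldNormedType.Exports.

Set Implicit Arguments.
Unset Strict Implicit.
Unset Printing Implicit Defensive.

Local Open Scope classical_set_scope.
Local Open Scope ring_scope.

(* A function on [0,1] (resp. [0,1]^2) is represented by a function on R
   (resp. R^2) of which only the values at points of [0,1] (resp. [0,1]^2)
   matter: every condition, including continuity (relative to the subspace
   topology) and equality of functions, is restricted to these points. *)

Section FuzzyConnectives.
Variable R : realType.

Definition unit_itv : set R := `[0, 1].

Definition maps_unit1 (f : R -> R) : Prop :=
  forall x, unit_itv x -> unit_itv (f x).

Definition maps_unit2 (f : R -> R -> R) : Prop :=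
  forall x y, unit_itv x -> unit_itv y -> unit_itv (f x y).

Definition commutative_on_unit (f : R -> R -> R) : Prop :=
  forall x y, unit_itv x -> unit_itv y -> f x y = f y x.

Definition increasing_on_unit (f : R -> R -> R) : Prop :=
  (forall x x' y, unit_itv x -> unit_itv x' -> unit_itv y ->
     x <= x' -> f x y <= f x' y) /\
  (forall x y y', unit_itv x -> unit_itv y -> unit_itv y' ->
     y <= y' -> f x y <= f x y').

Definition continuous_on_unit (f : R -> R -> R) : Prop :=
  {within unit_itv `*` unit_itv, continuous (fun p : R * R => f p.1 p.2)}.

Record fuzzy_negation (N : R -> R) : Prop := FuzzyNegation {
  negation_maps : maps_unit1 N;
  negation0 : N 0 = 1;
  negation1 : N 1 = 0;
  negation_decreasing : forall x y, unit_itv x -> unit_itv y ->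
    y <= x -> N x <= N y }.

Record general_overlap (GO : R -> R -> R) : Prop := GeneralOverlap {
  overlap_maps : maps_unit2 GO;
  overlap_comm : commutative_on_unit GO;
  overlap0 : forall x y, unit_itv x -> unit_itv y ->
    x * y = 0 -> GO x y = 0;
  overlap1 : forall x y, unit_itv x -> unit_itv y ->
    x * y = 1 -> GO x y = 1;
  overlap_increasing : increasing_on_unit GO;
  overlap_continuous : continuous_on_unit GO }.

Record grouping (G : R -> R -> R) : Prop := Grouping {
  grouping_maps : maps_unit2 G;
  grouping_comm : commutative_on_unit G;
  grouping_continuous : continuous_on_unit G;
  grouping_increasing : increasing_on_unit G;
  grouping0 : forall x y, unit_itv x -> unit_itv y ->
    (G x y = 0 <-> x = 0 /\ y = 0);
  grouping1 : forall x y, unit_itv x -> unit_itv y ->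
    (G x y = 1 <-> x = 1 \/ y = 1) }.

Definition GN_implication (I : R -> R -> R) : Prop :=
  exists (G : R -> R -> R) (N : R -> R),
    [/\ grouping G, fuzzy_negation N &
        forall x y, unit_itv x -> unit_itv y -> I x y = G (N x) y].

Definition GON_implication (I : R -> R -> R) : Prop :=
  exists (GO : R -> R -> R) (M : R -> R),
    [/\ general_overlap GO, fuzzy_negation M &
        forall x y, unit_itv x -> unit_itv y -> I x y = M (GO x (M y))].

End FuzzyConnectives.

(* Main.v *)
Require Import Defs.
From HB Require Import structures.
From mathcomp Require Import all_boot all_order all_algebra.
From mathcomp Require Import all_classical all_reals all_analysis.
Import Order.TTheory GRing.Theory Num.Theory.
Import numFieldNormedType.Exports.
Local Open Scope ring_scope.

Set Implicit Arguments.
Unset Strict Implicit.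
Unset Printing Implicit Defensive.

(** The witness is [I x y = max (N x) y], where [N] is the crisp negation: it
    is [1] at [0] and [0] elsewhere.  Suppose [I x y = M (GO x (M y))].

    Since [N 1 = 0], the number [1] is a left identity of [I], so that
    [y = M (GO 1 (M y))] and hence [M] is injective
    ([GON_left_identity_injective]).  On the other hand
    [N x = I x 0 = M (GO x 1)].  The section [GO _ 1] is continuous and runs
    from [0] to [1], so it takes the value [1/2] at some point [c]
    ([general_overlap_section_onto]).  Injectivity then keeps
    [N c = M (1/2)] away from [M 0 = 1] and [M 1 = 0], whereas a crisp
    negation takes no other value. *)

Section CrispMaxImplication.
Variable R : realType.
Implicit Types (M : R -> R) (I GO : R -> R -> R).

Lemma unit_itvE (x : R) : @unit_itv R x <-> 0 <= x <= 1.
Proof. by rewrite /unit_itv /= in_itv. Qed.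

Lemma unit_itv0 : @unit_itv R 0.
Proof. by apply/unit_itvE; rewrite lexx ler01. Qed.

Lemma unit_itv1 : @unit_itv R 1.
Proof. by apply/unit_itvE; rewrite lexx ler01. Qed.

Lemma grouping_max : grouping (fun x y : R => Num.max x y).
Proof.
split.
- by move=> x y ux uy; case: leP.
- by move=> x y _ _; rewrite maxC.
- exact/continuous_subspaceT/max_continuous.
- by split=> x y z _ _ _ h; rewrite ge_max !le_max ?h ?lexx ?orbT.
- move=> x y /unit_itvE/andP[x0 _] /unit_itvE/andP[y0 _].
  split=> [m0|[-> ->]]; last exact: maxxx.
  have: Num.max x y <= 0 by rewrite m0.
  by rewrite ge_max => /andP[x_le0 y_le0]; split; apply/le_anti/andP.
- move=> x y /unit_itvE/andP[_ x1] /unit_itvE/andP[_ y1].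
  split=> [|[->|->]]; last 2 first.
  + exact: max_l.
  + exact: max_r.
  + by case: leP => _ h; [right|left].
Qed.

Definition crisp_negation (x : R) : R := (x == 0)%:R.

Lemma fuzzy_negation_crisp : fuzzy_negation crisp_negation.
Proof.
split; rewrite /crisp_negation.
- by move=> x _; case: eqP => _; [exact: unit_itv1|exact: unit_itv0].
- by rewrite eqxx.
- by rewrite oner_eq0.
- move=> x y _ /unit_itvE/andP[y0 _] yx; rewrite ler_nat.
  have [x0|//] := eqVneq x 0.
  by rewrite x0 in yx; rewrite eq_le yx y0.
Qed.

(** This is the intermediate value theorem for [GO _ 1], which is [0] at [0] and
    [1] at [1]. *)
Lemma general_overlap_section_onto GO (v : R) : general_overlap GO ->
  @unit_itv R v -> exists2 c, @unit_itv R c & GO c 1 = v.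
Proof.
move=> ov /unit_itvE v01.
have GO01 : GO 0 1 = 0.
  by apply: (overlap0 ov); rewrite ?mul0r //; [exact: unit_itv0|exact: unit_itv1].
have GO11 : GO 1 1 = 1.
  by apply: (overlap1 ov); rewrite ?mulr1 //; exact: unit_itv1.
have cont : {within `[0, 1], continuous (GO^~ 1)}%classic.
  apply/subspace_continuousP => x ux.
  have /subspace_continuousP/(_ (x, 1)) := overlap_continuous ov.
  move=> /(_ (conj ux unit_itv1)) /= GOx.
  apply: cvg_trans GOx => A /=; rewrite /within /= !nbhs_simpl /=.
  (* Points [t] of the unit interval near [x] give points [(t, 1)] of the unit
     square near [(x, 1)]. *)
  have x1 : ((t, 1 : R) @[t --> x] --> (x, 1 : R))%classic.
    exact: (cvg_pair cvg_id (@cvg_cst _ (1 : R) _ (nbhs x) _)).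
  move=> /x1; rewrite /= !nbhs_simpl /=.
  apply: filterS => t /= At ut; apply: At; split => //; exact: unit_itv1.
have [|c cin <-] := @IVT R (GO^~ 1) 0 1 v ler01 cont.
  by rewrite GO01 GO11 min_l ?max_r ?ler01.
by exists c => //; apply/unit_itvE; rewrite in_itv in cin.
Qed.

(** The equation [y = M (GO 1 (M y))] exhibits a left inverse of [M]. *)
Lemma GON_left_identity_injective I GO M :
  (forall x y, @unit_itv R x -> @unit_itv R y -> I x y = M (GO x (M y))) ->
  (forall y, @unit_itv R y -> I 1 y = y) ->
  forall y z, @unit_itv R y -> @unit_itv R z -> M y = M z -> y = z.
Proof.
move=> IE I1 y z uy uz Myz.
by rewrite -(I1 y uy) -(I1 z uz) !IE ?Myz //; exact: unit_itv1.
Qed.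

(** The natural negation [I _ 0] of [I] is [M] composed with [GO _ 1]; as [M] is
    injective, the point where [GO _ 1] equals [1/2] is mapped neither to
    [M 1 = 0] nor to [M 0 = 1]. *)
Lemma GON_left_identity_not_crisp I : GON_implication I ->
  (forall y, @unit_itv R y -> I 1 y = y) ->
  exists2 c, @unit_itv R c & I c 0 != 0 /\ I c 0 != 1.
Proof.
move=> [GO [M [ov neg IE]]] I1.
have injM := @GON_left_identity_injective I GO M IE I1.
have uhalf : @unit_itv R 2^-1.
  by apply/unit_itvE; rewrite invr_ge0 ler0n invf_le1 ?ler1n.
have [c uc GOc] := general_overlap_section_onto ov uhalf.
exists c => //; rewrite IE ?(negation0 neg) ?GOc //; last exact: unit_itv0.
split; apply/eqP => Mhalf.
- have /eqP := injM _ _ uhalf unit_itv1 (etrans Mhalf (esym (negation1 neg))).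
  by rewrite invr_eq1 pnatr_eq1.
- have /eqP := injM _ _ uhalf unit_itv0 (etrans Mhalf (esym (negation0 neg))).
  by rewrite invr_eq0 pnatr_eq0.
Qed.

End CrispMaxImplication.

Theorem proposition23 (R : realType) :
  exists I : R -> R -> R, GN_implication I /\ ~ GON_implication I.
Proof.
exists (fun x y => Num.max (crisp_negation x) y); split.
  exists (fun x y => Num.max x y), (@crisp_negation R).
  by split=> //; [exact: grouping_max|exact: fuzzy_negation_crisp].
move=> /GON_left_identity_not_crisp[y /unit_itvE/andP[y0 _]|c _].
  by rewrite /crisp_negation oner_eq0 max_r.
rewrite /crisp_negation; case: (c =P 0) => _ [/eqP c0 /eqP c1].
- by apply: c1; rewrite max_l ?ler01.
- by apply: c0; rewrite max_l.
Qed.
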